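(* Let $A\in\mathcal{V}$ and let $g:B(Con(A))\rightarrow Clop(Max(A))$ be the map $g(\alpha)=Max(A)\cap D_A(\alpha)$. Then $Rad(A)$ has $CBLP$ if and only if $g$ is a Boolean isomorphism.
   Context: $\mathcal{V}$ is a congruence modular, semidegenerate variety (no nontrivial algebra has a one-element subalgebra) of finite signature. For $B\in\mathcal{V}$: $Con(B)$ is its congruence lattice with bounds $\Delta_B,\nabla_B$, $[\cdot,\cdot]$ the Freese–McKenzie commutator, $K(B)$ the compact congruences. A congruence $\phi\neq\nabla_B$ is prime if $[\alpha,\beta]\subseteq\phi$ implies $\alpha\subseteq\phi$ or $\beta\subseteq\phi$; $Spec(B)$ is the set of primes, $Max(B)$ the set of maximal congruences, $Rad(B)=\bigcap Max(B)$; $\rho(\theta)$ is the intersection of primes containing $\theta$. $D_B(\theta)=\{\phi\in Spec(B):\theta\not\subseteq\phi\}$; these are the open sets of the topology on $Spec(B)$, and $Max(B)$ has the subspace topology; $Clop(X)$ is the Boolean algebra of clopen subsets of $X$. $B(Con(B))$ is the Boolean algebra of complemented elements of $Con(B)$ (for $\alpha\in B(Con(A))$, $Max(A)\cap D_A(\alpha)$ is clopen in $Max(A)$ and $g$ is a Boolean morphism). When $K(B)$ is closed under the commutator, the reticulation $L(B)=K(B)/{\equiv}$ ($\alpha\equiv\beta$ iff $\rho(\alpha)=\rho(\beta)$) is a bounded distributive lattice with canonical map $\lambda_B$, mapping $B(Con(B))$ injectively into $B(L(B))$; the reticulation preserves the Boolean center if this map is onto $B(L(B))$. Standing assumption: for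 every $B\in\mathcal{V}$, $K(B)$ is closed under the commutator and the reticulation of $B$ preserves the Boolean center. A congruence $\theta$ of $A$ has $CBLP$ if for every $\beta\in B(Con(A/\theta))$ there is $\alpha\in B(Con(A))$ with $(\alpha\vee\theta)/\theta=\beta$. *)

(* Defs.v *)
From Stdlib Require Import List ClassicalEpsilon.
From mathcomp Require Import all_boot.

Unset Strict Implicit.
Unset Printing Implicit Defensive.

Record signature := Signature { sym : finType; ar : sym -> nat }.
Arguments ar {s} _.

Record algebra (S : signature) := Algebra {
  carrier :> Type;
  op : forall f : sym S, ('I_(ar f) -> carrier) -> carrier }.
Arguments op {S} a f _.

Inductive term (S : signature) (V : Type) : Type :=
  | Var : V -> term S V
  | App : forall f : sym S, ('I_(ar f) -> term S V) -> term S V.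
Arguments Var {S V} _.
Arguments App {S V} f _.

Fixpoint eval {S : signature} (A : algebra S) {V : Type} (e : V -> A)
  (t : term S V) : A :=
  match t with
  | Var v => e v
  | App f ts => op A f (fun i => eval A e (ts i))
  end.
Arguments eval {S} A {V} e t.

(* Identities are pairs of terms in countably many variables; the variety
   is the class of models of a set E of identities (Birkhoff). *)
Definition identity (S : signature) := (term S nat * term S nat)%type.

Definition in_var {S} (E : identity S -> Prop) (A : algebra S) : Prop :=
  forall id, E id -> forall e : nat -> A, eval A e id.1 = eval A e id.2.

Definition crel (T : Type) := T -> T -> Prop.
Definition subrel {T} (R Q : crel T) : Prop := forall x y, R x y -> Q x y.

Definition is_cong {S} (A : algebra S) (R : crel A) : Prop :=
  (forall x, R x x) /\ (forall x y, R x y -> R y x) /\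
  (forall x y z, R x y -> R y z -> R x z) /\
  (forall f (a b : 'I_(ar f) -> A), (forall i, R (a i) (b i)) ->
      R (op A f a) (op A f b)).

Definition Delta {S} (A : algebra S) : crel A := fun x y => x = y.
Definition Nabla {S} (A : algebra S) : crel A := fun _ _ => True.

Definition Cg {S} (A : algebra S) (R : crel A) : crel A :=
  fun x y => forall th, is_cong A th -> subrel R th -> th x y.

Definition cmeet {S} (A : algebra S) (a b : crel A) : crel A :=
  fun x y => a x y /\ b x y.
Definition cjoin {S} (A : algebra S) (a b : crel A) : crel A :=
  Cg A (fun x y => a x y \/ b x y).
Definition bigjoin {S} (A : algebra S) (F : crel A -> Prop) : crel A :=
  Cg A (fun x y => exists g, F g /\ g x y).

Definition is_compact {S} (A : algebra S) (th : crel A) : Prop :=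
  is_cong A th /\
  forall F : crel A -> Prop, (forall g, F g -> is_cong A g) ->
    subrel th (bigjoin A F) ->
    exists l : list (crel A), (forall g, List.In g l -> F g) /\
      subrel th (bigjoin A (fun g => List.In g l)).

Definition is_boolean {S} (A : algebra S) (a : crel A) : Prop :=
  is_cong A a /\ exists b, is_cong A b /\
    cmeet A a b = Delta A /\ cjoin A a b = Nabla A.

Definition env {T} (a c : nat -> T) : nat + nat -> T :=
  fun v => match v with inl i => a i | inr j => c j end.

Definition centralizes {S} (A : algebra S) (al be de : crel A) : Prop :=
  forall (t : term S (nat + nat)) (a b c d : nat -> A),
    (forall i, al (a i) (b i)) -> (forall j, be (c j) (d j)) ->
    de (eval A (env a c) t) (eval A (env a d) t) ->
    de (eval A (env b c) t) (eval A (env b d) t).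

(* [alpha, beta] = the least congruence delta with C(alpha, beta; delta);
   in congruence modular varieties this is the Freese-McKenzie commutator *)
Definition comm {S} (A : algebra S) (al be : crel A) : crel A :=
  fun x y => forall de, is_cong A de -> centralizes A al be de -> de x y.

Definition is_prime {S} (A : algebra S) (p : crel A) : Prop :=
  is_cong A p /\ p <> Nabla A /\
  forall al be, is_cong A al -> is_cong A be ->
    subrel (comm A al be) p -> subrel al p \/ subrel be p.

Definition is_max {S} (A : algebra S) (p : crel A) : Prop :=
  is_cong A p /\ p <> Nabla A /\
  forall q, is_cong A q -> subrel p q -> q = p \/ q = Nabla A.

Definition Rad {S} (A : algebra S) : crel A :=
  fun x y => forall p, is_max A p -> p x y.

Definition rho {S} (A : algebra S) (th : crel A) : crel A :=
  fun x y => forall p, is_prime A p -> subrel th p -> p x y.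

Definition compact_comm_closed {S} (B : algebra S) : Prop :=
  forall al be, is_compact B al -> is_compact B be -> is_compact B (comm B al be).

(* The reticulation L(B) = K(B)/== with lambda(a) /\ lambda(b) = lambda([a,b]),
   lambda(a) \/ lambda(b) = lambda(a \/ b), 0 = lambda(Delta), 1 = lambda(Nabla),
   and lambda(a) = lambda(b) iff rho a = rho b.  "The reticulation preserves the
   Boolean center": every complemented element of L(B) is lambda of a
   complemented congruence. *)
Definition ret_preserves_bc {S} (B : algebra S) : Prop :=
  forall al, is_compact B al ->
    (exists be, is_compact B be /\
       rho B (comm B al be) = rho B (Delta B) /\
       rho B (cjoin B al be) = rho B (Nabla B)) ->
    exists ga, is_boolean B ga /\ rho B ga = rho B al.

Definition cong_modular_var {S} (E : identity S -> Prop) : Prop :=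
  forall B : algebra S, in_var E B ->
    forall a b c, is_cong B a -> is_cong B b -> is_cong B c -> subrel a c ->
      cjoin B a (cmeet B b c) = cmeet B (cjoin B a b) c.

Definition semidegenerate_var {S} (E : identity S -> Prop) : Prop :=
  forall B : algebra S, in_var E B -> (exists x y : B, x <> y) ->
    ~ (exists b : B, forall f (args : 'I_(ar f) -> B),
         (forall i, args i = b) -> op B f args = b).

Definition qcar {S} (A : algebra S) (th : crel A) : Type :=
  {P : A -> Prop | exists a, P = th a}.

Definition qclass {S} (A : algebra S) (th : crel A) (a : A) : qcar A th :=
  exist _ (th a) (ex_intro _ a erefl).

Definition qrep {S} (A : algebra S) (th : crel A) (p : qcar A th) : A :=
  proj1_sig (constructive_indefinite_description _ (proj2_sig p)).

Definition quotient {S} (A : algebra S) (th : crel A) : algebra S :=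
  @Algebra S (qcar A th)
    (fun f args => qclass A th (op A f (fun i => qrep A th (args i)))).

Definition qrel {S} (A : algebra S) (th g : crel A) : crel (quotient A th) :=
  fun p q => exists a b, p = qclass A th a /\ q = qclass A th b /\ g a b.

Definition CBLP {S} (A : algebra S) (th : crel A) : Prop :=
  forall be, is_boolean (quotient A th) be ->
    exists al, is_boolean A al /\ qrel A th (cjoin A al th) = be.

Definition open_max {S} (A : algebra S) (U : crel A -> Prop) : Prop :=
  exists th, is_cong A th /\ U = (fun p => is_max A p /\ ~ subrel th p).

Definition clopen_max {S} (A : algebra S) (U : crel A -> Prop) : Prop :=
  open_max A U /\ open_max A (fun p => is_max A p /\ ~ U p).

Definition gmap {S} (A : algebra S) (al : crel A) : crel A -> Prop :=
  fun p => is_max A p /\ ~ subrel al p.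

Definition g_bool_iso {S} (A : algebra S) : Prop :=
  (forall al, is_boolean A al -> clopen_max A (gmap A al)) /\
  (forall al be, is_boolean A al -> is_boolean A be ->
     gmap A (cmeet A al be) = (fun p => gmap A al p /\ gmap A be p)) /\
  (forall al be, is_boolean A al -> is_boolean A be ->
     gmap A (cjoin A al be) = (fun p => gmap A al p \/ gmap A be p)) /\
  gmap A (Delta A) = (fun _ => False) /\
  gmap A (Nabla A) = is_max A /\
  (forall al be, is_boolean A al -> is_boolean A be ->
     gmap A al = gmap A be -> al = be) /\
  (forall U, clopen_max A U -> exists al, is_boolean A al /\ gmap A al = U).

(* Main.v *)
(* The key fact is that a /\ b <= d and a \/ d = Nabla imply b <= d
   (sub_of_cmeet_sub); it replaces the commutator identity [Nabla, b] = b.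
   Hence maximal congruences are meet-prime, and a congruence b with a
   complement modulo d is contained in d as soon as every maximal congruence
   above d contains b.  The latter gives the injectivity of g (modulo Delta)
   and identifies congruences of A / Rad A with the same maximal congruences
   above them (modulo Rad A).  A clopen set of maximal congruences, together
   with its complement, is given by two congruences that are complementary
   modulo Rad A, so clopen sets correspond to B(Con(A / Rad A)) and the
   surjectivity of g is CBLP for Rad A. *)

From mathcomp Require Import all_boot.
From mathcomp Require classical_sets.
From Stdlib Require Import Classical ClassicalEpsilon FunctionalExtensionality
  PropExtensionality ProofIrrelevance.
Require Import Defs.

(** * Extensionality of relations and predicates *)

Lemma crel_ext T (R Q : crel T) : subrel R Q -> subrel Q R -> R = Q.
Proof.
move=> RQ QR; apply: functional_extensionality => x.
apply: functional_extensionality => y; apply: propositional_extensionality.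
by split; [exact: RQ | exact: QR].
Qed.

Lemma pred_ext T (P Q : T -> Prop) : (forall x, P x <-> Q x) -> P = Q.
Proof.
by move=> PQ; apply: functional_extensionality => x;
   apply: propositional_extensionality.
Qed.

(** * Congruences *)

Lemma cmeet_cong {S} {A : algebra S} {a b : crel A} :
  is_cong A a -> is_cong A b -> is_cong A (cmeet A a b).
Proof.
move=> [ar [as_ [at_ ao]]] [br [bs [bt bo]]]; split; [|split; [|split]].
- by move=> x; split; [exact: ar | exact: br].
- by move=> x y [? ?]; split; [exact: as_ | exact: bs].
- by move=> x y z [? ?] [? ?]; split; [apply: at_ | apply: bt]; eassumption.
- by move=> f u v h; split; [apply: ao | apply: bo] => i; case: (h i).
Qed.

Lemma Cg_cong {S} (A : algebra S) (R : crel A) : is_cong A (Cg A R).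
Proof.
split; [|split; [|split]].
- by move=> x th [].
- by move=> x y h th Hth Rth; case: (Hth) => _ [s _]; apply: s; apply: h.
- move=> x y z h k th Hth Rth; case: (Hth) => _ [_ [t _]].
  by apply: t (h _ Hth Rth) (k _ Hth Rth).
- move=> f u v h th Hth Rth; case: (Hth) => _ [_ [_ o]].
  by apply: o => i; apply: h.
Qed.

Lemma cjoin_cong {S} (A : algebra S) (a b : crel A) : is_cong A (cjoin A a b).
Proof. exact: Cg_cong. Qed.

Lemma cjoinl {S} (A : algebra S) (a b : crel A) : subrel a (cjoin A a b).
Proof. by move=> x y h th _; apply; left. Qed.

Lemma cjoinr {S} (A : algebra S) (a b : crel A) : subrel b (cjoin A a b).
Proof. by move=> x y h th _; apply; right. Qed.

Lemma cjoin_sub {S} (A : algebra S) (a b c : crel A) :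
  is_cong A c -> subrel a c -> subrel b c -> subrel (cjoin A a b) c.
Proof. by move=> Hc ac bc x y; apply => // u v []; [apply: ac | apply: bc]. Qed.

Lemma Nabla_sub {S} (A : algebra S) (a : crel A) :
  subrel (Nabla A) a -> a = Nabla A.
Proof. by move=> h; apply: crel_ext => // x y _; apply: h. Qed.

Lemma Rad_cong {S} (A : algebra S) : is_cong A (Rad A).
Proof.
split; [|split; [|split]].
- by move=> x p [[]].
- by move=> x y h p Hp; case: (Hp) => -[_ [s _]] _; apply: s; apply: h.
- move=> x y z h k p Hp; case: (Hp) => -[_ [_ [t _]]] _.
  by apply: t (h _ Hp) (k _ Hp).
- move=> f u v h p Hp; case: (Hp) => -[_ [_ [_ o]]] _.
  by apply: o => i; apply: h.
Qed.

Definition is_equiv {T} (e : crel T) : Prop :=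
  (forall x, e x x) /\ (forall x y, e x y -> e y x) /\
  (forall x y z, e x y -> e y z -> e x z).

(* The join of two congruences in the lattice of equivalence relations is
   already compatible with the operations: arguments are replaced one at a
   time. *)
Lemma cjoin_sub_equiv {S} (A : algebra S) (a b e : crel A) :
  is_cong A a -> is_cong A b -> is_equiv e -> subrel a e -> subrel b e ->
  subrel (cjoin A a b) e.
Proof.
move=> [a1 [_ [_ ao]]] [b1 [_ [_ bo]]] He ae be x y.
pose J : crel A := fun x y =>
  forall e, is_equiv e -> subrel a e -> subrel b e -> e x y.
move=> /(_ J) h; apply: h => // {x y e He ae be}; last first.
  by move=> x y [h|h] e He ae be; [exact: ae | exact: be].
split; [|split; [|split]].
- by move=> x e [r _] _ _; apply: r.
- by move=> x y h e He ae be; case: (He) => _ [s _]; apply: s; apply: h.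
- move=> x y z h k e He ae be; case: (He) => _ [_ t].
  by apply: t (h _ He ae be) (k _ He ae be).
move=> f x y xy e He ae be; case: (He) => er [es et].
(* The first [k] arguments come from [y] and the others from [x], so [hyb 0] is [x] and [hyb (ar f)]
   is [y]. *)
pose hyb k (i : 'I_(ar f)) := if i < k then y i else x i.
suff H k : k <= ar f -> e (op A f x) (op A f (hyb k)).
  have := H (ar f) (leqnn _); congr (e _ (op A f _)).
  by apply: functional_extensionality => i; rewrite /hyb ltn_ord.
elim: k => [_|k IH lekn].
  have -> : hyb 0 = x by apply: functional_extensionality.
  exact: er.
apply: (et _ _ _ (IH (ltnW lekn))).
pose ik := Ordinal lekn.
pose ins u (i : 'I_(ar f)) := if i == ik then u else hyb k i.
have -> : hyb k = ins (x ik).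
  apply: functional_extensionality => i; rewrite /ins /hyb.
  by case: eqP => // ->; rewrite ltnn.
have -> : hyb k.+1 = ins (y ik).
  apply: functional_extensionality => i; rewrite /ins /hyb ltnS.
  case: eqP => [-> | /eqP ne]; first by rewrite leqnn.
  by rewrite leq_eqVlt -[_ == k]/(_ == ik) (negbTE ne).
(* [xy] is used for the pullback of [e] along [u |-> op A f (ins u)], an equivalence that contains
   [a] and [b] because they are compatible with [f]. *)
apply: (xy ik (fun u v => e (op A f (ins u)) (op A f (ins v)))).
- split; [|split] => *; [exact: er | exact: es | by apply: et; eassumption].
- by move=> u v uv; apply: ae; apply: ao => i; rewrite /ins; case: eqP.
- by move=> u v uv; apply: be; apply: bo => i; rewrite /ins; case: eqP.
Qed.

(** * Quotients *)

Lemma qclass_eq {S} {A : algebra S} {th : crel A} :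
  is_cong A th -> forall a b, qclass A th a = qclass A th b <-> th a b.
Proof.
move=> [r [s [t _]]] a b; split.
  by move=> /(f_equal (fun q => proj1_sig q b)) /= ->; apply: r.
move=> ab; apply: subset_eq_compat; apply: pred_ext => c.
by split; apply: t => //; apply: s.
Qed.

Lemma qrepK {S} {A : algebra S} {th : crel A} (p : qcar A th) :
  qclass A th (qrep A th p) = p.
Proof.
rewrite /qrep; case: constructive_indefinite_description => a /= e.
by case: p e => P HP /= e; apply: subset_eq_compat.
Qed.

Lemma op_qclass {S} {A : algebra S} {th : crel A} : is_cong A th ->
  forall f (u : 'I_(ar f) -> A),
  op (quotient A th) f (fun i => qclass A th (u i)) = qclass A th (op A f u).
Proof.
move=> H f u; apply/(qclass_eq H); case: (H) => _ [_ [_ o]]; apply: o => i.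
by apply/(qclass_eq H); rewrite qrepK.
Qed.

Lemma eval_qclass {S} {A : algebra S} {th : crel A} : is_cong A th ->
  forall V (e : V -> A) t,
  eval (quotient A th) (fun v => qclass A th (e v)) t = qclass A th (eval A e t).
Proof.
move=> H V e; elim=> [//|f ts IH].
apply: etrans (op_qclass H f _); congr (op (quotient A th) f _).
exact: functional_extensionality IH.
Qed.

Lemma in_var_quotient {S} {E : identity S -> Prop} {A : algebra S}
  {th : crel A} : is_cong A th -> in_var E A -> in_var E (quotient A th).
Proof.
move=> H HA id Eid e.
have -> : e = fun v => qclass A th (qrep A th (e v)).
  by apply: functional_extensionality => v; rewrite qrepK.
by rewrite !(eval_qclass H) (HA _ Eid).
Qed.

(** Inverse of [qrel] in the correspondence between the congruences of the quotient and those of [A]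
    above [th]. *)
Definition qlift {S} (A : algebra S) (th : crel A) (be : crel (quotient A th)) :
  crel A := fun x y => be (qclass A th x) (qclass A th y).

Lemma qlift_cong {S} {A : algebra S} {th : crel A} (be : crel (quotient A th)) :
  is_cong A th -> is_cong (quotient A th) be -> is_cong A (qlift A th be).
Proof.
move=> H [r [s [t o]]]; split; [|split; [|split]]; rewrite /qlift.
- by move=> x; apply: r.
- by move=> x y; apply: s.
- by move=> x y z; apply: t.
- by move=> f u v h; rewrite -!(op_qclass H); apply: o.
Qed.

Lemma sub_qlift {S} {A : algebra S} {th : crel A} (be : crel (quotient A th)) :
  is_cong A th -> is_cong (quotient A th) be -> subrel th (qlift A th be).
Proof.
by move=> H [r _] x y /(qclass_eq H) xy; rewrite /qlift xy; apply: r.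
Qed.

Lemma qrel_qlift {S} (A : algebra S) (th : crel A) (be : crel (quotient A th)) :
  qrel A th (qlift A th be) = be.
Proof.
apply: crel_ext => p q; first by move=> [a [b [-> [-> ]]]].
by move=> h; exists (qrep A th p), (qrep A th q); rewrite /qlift !qrepK.
Qed.

Lemma qrelE {S} {A : algebra S} {th g : crel A} :
  is_cong A th -> is_cong A g -> subrel th g ->
  forall x y, qrel A th g (qclass A th x) (qclass A th y) <-> g x y.
Proof.
move=> H [_ [s [t _]]] thg x y; split; last by exists x, y.
move=> [a [b [/(qclass_eq H) xa [/(qclass_eq H) yb ab]]]].
by apply: t (thg _ _ xa) (t _ _ _ ab (s _ _ (thg _ _ yb))).
Qed.

Lemma qrel_cong {S} {A : algebra S} {th g : crel A} :
  is_cong A th -> is_cong A g -> subrel th g ->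
  is_cong (quotient A th) (qrel A th g).
Proof.
move=> H Hg thg; have E := qrelE H Hg thg.
case: (Hg) => [r [s [t o]]]; split; [|split; [|split]].
- by move=> x; rewrite -(qrepK x); apply/E.
- by move=> x y; rewrite -(qrepK x) -(qrepK y) => /E h; apply/E; apply: s.
- move=> x y z; rewrite -(qrepK x) -(qrepK y) -(qrepK z) => /E h /E k.
  by apply/E; apply: t k.
- move=> f u v h; apply/E; apply: o => i; apply/E.
  by rewrite !qrepK.
Qed.

(** A complement in the quotient becomes a complement in the interval above [th]; [boolean_qrel]
    goes the other way. Complemented congruences of the quotient can thus be handled inside [A]. *)
Lemma boolean_qlift {S} {A : algebra S} {th : crel A}
  (be : crel (quotient A th)) : is_cong A th ->
  is_boolean (quotient A th) be ->
  exists c, is_cong A c /\ subrel th c /\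
    subrel (cmeet A (qlift A th be) c) th /\
    cjoin A (qlift A th be) c = Nabla A.
Proof.
move=> H [Hb [ga [Hg [m j]]]]; exists (qlift A th ga); split; [|split; [|split]].
- exact: qlift_cong.
- exact: sub_qlift.
- move=> x y h; apply/(qclass_eq H).
  by rewrite -[_ = _]/(Delta (quotient A th) _ _) -m.
(* The image of the join of the two lifts is a congruence containing [be] and [ga], hence it is
   total. *)
set c := cjoin _ _ _; have Hc : is_cong A c by exact: cjoin_cong.
have thc : subrel th c.
  by move=> x y /(sub_qlift _ H Hb) h; apply: cjoinl.
apply: Nabla_sub => x y _; apply/(qrelE H Hc thc).
have : cjoin (quotient A th) be ga (qclass A th x) (qclass A th y) by rewrite j.
apply: cjoin_sub; first exact: qrel_cong.
- rewrite -{1}(qrel_qlift _ _ be) => p q [a [b [-> [-> h]]]].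
  by exists a, b; split=> //; split=> //; apply: cjoinl.
- rewrite -{1}(qrel_qlift _ _ ga) => p q [a [b [-> [-> h]]]].
  by exists a, b; split=> //; split=> //; apply: cjoinr.
Qed.

Lemma boolean_qrel {S} {A : algebra S} {th b c : crel A} :
  is_cong A th -> is_cong A b -> is_cong A c -> subrel th b -> subrel th c ->
  subrel (cmeet A b c) th -> cjoin A b c = Nabla A ->
  is_boolean (quotient A th) (qrel A th b).
Proof.
move=> H Hb Hc thb thc m j; split; first exact: qrel_cong.
exists (qrel A th c); split; first exact: qrel_cong.
split.
  apply: crel_ext => p q.
    rewrite -(qrepK p) -(qrepK q) => -[/(qrelE H Hb thb) h].
    by move=> /(qrelE H Hc thc) k; apply/(qclass_eq H); apply: m.
  move=> ->; split; [case: (qrel_cong H Hb thb) | case: (qrel_cong H Hc thc)];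
    by move=> r _; apply: r.
apply: Nabla_sub => p q _; rewrite -(qrepK p) -(qrepK q).
set J := cjoin _ _ _.
have HJ : is_cong _ J by exact: cjoin_cong.
have : cjoin A b c (qrep A th p) (qrep A th q) by rewrite j.
apply: (cjoin_sub _ _ _ (qlift A th J)); first exact: qlift_cong.
- by move=> x y h; apply: cjoinl; exists x, y.
- by move=> x y h; apply: cjoinr; exists x, y.
Qed.

(** * Subalgebras of the square *)

(** A congruence is a subalgebra of A x A, so it lies in the variety and semidegeneracy can be
    applied to it. *)
Definition cong_alg {S} (A : algebra S) (b : crel A) (Hb : is_cong A b) :
  algebra S :=
  @Algebra S {p : A * A | b p.1 p.2} (fun f args =>
    exist (fun p : A * A => b p.1 p.2)
      (op A f (fun i => (proj1_sig (args i)).1),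
       op A f (fun i => (proj1_sig (args i)).2))
      (proj2 (proj2 (proj2 Hb)) f _ _ (fun i => proj2_sig (args i)))).

Lemma eval_cong_alg {S} {A : algebra S} {b : crel A} (Hb : is_cong A b) V
  (e : V -> cong_alg A b Hb) t :
  proj1_sig (eval (cong_alg A b Hb) e t) =
  (eval A (fun v => (proj1_sig (e v)).1) t,
   eval A (fun v => (proj1_sig (e v)).2) t).
Proof.
elim: t => [v|f ts IH] /=; first by case: (e v) => -[].
by congr (op A f _, op A f _); apply: functional_extensionality => i;
   rewrite IH.
Qed.

Lemma in_var_cong_alg {S} {E : identity S -> Prop} {A : algebra S}
  {b : crel A} (Hb : is_cong A b) : in_var E A -> in_var E (cong_alg A b Hb).
Proof.
move=> HA id Eid e.
have : proj1_sig (eval (cong_alg A b Hb) e id.1) =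
       proj1_sig (eval (cong_alg A b Hb) e id.2).
  by rewrite !eval_cong_alg !(HA _ Eid).
by case: (eval _ _ _) => p ?; case: (eval _ _ _) => q ? /= pq;
   apply: subset_eq_compat.
Qed.

Definition coordinatewise {S} {A : algebra S} {b : crel A} (Hb : is_cong A b)
  (x : crel A) : crel (cong_alg A b Hb) :=
  fun p q => x (proj1_sig p).1 (proj1_sig q).1 /\
             x (proj1_sig p).2 (proj1_sig q).2.

Lemma coordinatewise_cong {S} {A : algebra S} {b : crel A} (Hb : is_cong A b)
  (x : crel A) : is_cong A x -> is_cong _ (coordinatewise Hb x).
Proof.
move=> [r [s [t o]]]; split; [|split; [|split]].
- by move=> p; split; apply: r.
- by move=> p q [? ?]; split; apply: s.
- by move=> p q u [? ?] [? ?]; split; apply: t; eassumption.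
- by move=> f u v h; split; apply: o => i; case: (h i).
Qed.

(** * Modular semidegenerate varieties *)

(** Gumm's shifting lemma. The path z, x, y, u puts (z, u) in ((d /\ b) \/ a) /\ b, which by
    modularity is (d /\ b) \/ (a /\ b), a congruence below d. *)
Lemma shifting {S} {E : identity S -> Prop} (HCM : cong_modular_var E)
  (A : algebra S) (HA : in_var E A) (a b d : crel A) :
  is_cong A a -> is_cong A b -> is_cong A d -> subrel (cmeet A a b) d ->
  forall x y z u, b x y -> b z u -> a x z -> a y u -> d x y -> d z u.
Proof.
move=> Ha Hb Hd abd x y z u bxy bzu axz ayu dxy.
have M := HCM A HA (cmeet A d b) a b (cmeet_cong Hd Hb) Ha Hb
  (fun _ _ => @proj2 _ _).
have : cmeet A (cjoin A (cmeet A d b) a) b z u.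
  split=> //; case: (cjoin_cong A (cmeet A d b) a) => _ [s [t _]].
  apply: (t _ x); first by apply: s; apply: cjoinr.
  by apply: (t _ y); [apply: cjoinl | apply: cjoinr].
by rewrite -M; apply: cjoin_sub => // v w [].
Qed.

(** The class of [b] is a one-element subalgebra of the quotient by [R], which is therefore
    trivial. *)
Lemma semidegenerate_cong_total {S} {E : identity S -> Prop}
  (Hsd : semidegenerate_var E) (B : algebra S) (HB : in_var E B) (R : crel B) :
  is_cong B R -> forall b, (forall f, R b (op B f (fun _ => b))) ->
  R = Nabla B.
Proof.
move=> HR b Rb; apply: Nabla_sub => x y _; apply: NNPP => nxy.
apply: (Hsd (quotient B R)); first exact: in_var_quotient.
  by exists (qclass B R x), (qclass B R y) => /(qclass_eq HR).
exists (qclass B R b) => f args h.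
have -> : args = fun _ => qclass B R b by apply: functional_extensionality.
rewrite (op_qclass HR); apply/(qclass_eq HR).
by case: HR => _ [s _]; apply: s.
Qed.

(* In commutator terms: the shifting lemma gives C(a, b; d), hence
   C(a v d, b; d), that is [Nabla, b] <= d, while [Nabla, b] = b by
   semidegeneracy.  Concretely, inside the algebra b <= A x A the join of
   a x a and d x d collapses the diagonal and saturates the pairs lying in d;
   semidegeneracy makes it total. *)
Lemma sub_of_cmeet_sub {S} {E : identity S -> Prop} (HCM : cong_modular_var E)
  (Hsd : semidegenerate_var E) (A : algebra S) (HA : in_var E A)
  (a b d : crel A) : is_cong A a -> is_cong A b -> is_cong A d ->
  cjoin A a d = Nabla A -> subrel (cmeet A a b) d -> subrel b d.
Proof.
move=> Ha Hb Hd ad abd u v buv.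
pose B := cong_alg A b Hb.
pose R := cjoin B (coordinatewise Hb a) (coordinatewise Hb d).
have HR : is_cong B R by exact: cjoin_cong.
have br x : b x x by case: (Hb).
pose diag x : B := exist (fun p : A * A => b p.1 p.2) (x, x) (br x).
have Rdiag x y : R (diag x) (diag y).
  have : cjoin A a d x y by rewrite ad.
  apply: (cjoin_sub _ _ _ (fun x y => R (diag x) (diag y))).
  - case: HR => r [s [t o]]; split; [|split; [|split]].
    + by move=> z; apply: r.
    + by move=> ? ?; apply: s.
    + by move=> ? ? ?; apply: t.
    + move=> f p q h; have := o f _ _ h.
      by congr (R _ _); apply: subset_eq_compat.
  - by move=> ? ? ?; apply: cjoinl.
  - by move=> ? ? ?; apply: cjoinr.
have Rtot : R = Nabla B.
  apply: (semidegenerate_cong_total Hsd _ (in_var_cong_alg Hb HA) _ HR (diag u)).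
  move=> f; have := Rdiag u (op A f (fun _ => u)).
  by congr (R _ _); apply: subset_eq_compat.
pose uv : B := exist (fun p : A * A => b p.1 p.2) (u, v) buv.
have : R (diag u) uv by rewrite Rtot.
pose D (p : B) := d (proj1_sig p).1 (proj1_sig p).2.
(* [D] holds at [diag u] by reflexivity of [d], so saturation carries it over to [uv]. The relation
   [D p <-> D q] is visibly an equivalence, but its compatibility with the operations is not at
   hand; hence [cjoin_sub_equiv]. *)
suff sat : subrel R (fun p q => D p <-> D q).
  by move=> /sat [h _]; apply: h; rewrite /D /=; case: Hd.
apply: cjoin_sub_equiv.
- exact: coordinatewise_cong.
- exact: coordinatewise_cong.
- by split; [|split] => *; tauto.
(* The two pairs are the [b]-sides of a rectangle whose other sides lie in [a]. *)
- have sh := shifting HCM A HA a b d Ha Hb Hd abd.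
  case: Ha => _ [s _] [p bp] [q bq] [/= a1 a2]; rewrite /D /=.
  by split; apply: sh => //; apply: s.
- case: Hd => _ [s [t _]] [p bp] [q bq] [/= d1 d2]; rewrite /D /=.
  split=> h; first exact: t (s _ _ d1) (t _ _ _ h d2).
  exact: t d1 (t _ _ _ h (s _ _ d2)).
Qed.

(** * Maximal congruences *)

Lemma max_join {S} (A : algebra S) (p a : crel A) :
  is_max A p -> is_cong A a -> ~ subrel a p -> cjoin A a p = Nabla A.
Proof.
move=> [Hp [_ m]] Ha nap.
case: (m _ (cjoin_cong A a p) (cjoinr A a p)) => // e.
by case: nap; rewrite -e; apply: cjoinl.
Qed.

Lemma max_cmeet_prime {S} {E : identity S -> Prop} (HCM : cong_modular_var E)
  (Hsd : semidegenerate_var E) (A : algebra S) (HA : in_var E A)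
  (p a b : crel A) : is_max A p -> is_cong A a -> is_cong A b ->
  subrel (cmeet A a b) p -> subrel a p \/ subrel b p.
Proof.
move=> Hp Ha Hb abp; case: (classic (subrel a p)) => [|nap]; [by left | right].
apply: (sub_of_cmeet_sub HCM Hsd A HA a b p) => //; first by case: Hp.
exact: max_join.
Qed.

Lemma max_not_both {S} (A : algebra S) (p a b : crel A) : is_max A p ->
  cjoin A a b = Nabla A -> subrel a p -> subrel b p -> False.
Proof.
move=> [Hp [np _]] ab ap bp; apply: np; apply: Nabla_sub.
by rewrite -ab; apply: cjoin_sub.
Qed.

(** Finitely many conditions, each met somewhere in a chain, are met together at one member. It
    serves for the finitely many arguments of an operation and for the finitely many symbols of the
    signature. *)
Lemma chain_finite_bound (I : finType) T (F : T -> Prop) (le : crel T)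
  (Q : I -> T -> Prop) (t0 : T) : F t0 ->
  (forall t u, F t -> F u -> le t u \/ le u t) ->
  (forall i t u, le t u -> Q i t -> Q i u) ->
  (forall i, exists t, F t /\ Q i t) -> exists t, F t /\ forall i, Q i t.
Proof.
move=> Ft0 tot mono ex.
suff [t [Ft H]] : exists t, F t /\ forall i, i \in enum I -> Q i t.
  by exists t; split=> // i; apply: H; rewrite mem_enum.
elim: (enum I) => [|j s [t [Ft H]]]; first by exists t0.
have [u [Fu Qu]] := ex j.
case: (tot t u Ft Fu) => h; [exists u | exists t]; split=> // i;
  rewrite inE => /orP[/eqP ->|/H] //.
- by apply: mono.
- by apply: mono Qu.
Qed.

(* By semidegeneracy a congruence relating a point to its finitely many images
   under the basic operations is total, so unions of chains of proper
   congruences are proper. *)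
Lemma max_exists {S} {E : identity S -> Prop} (Hsd : semidegenerate_var E)
  (A : algebra S) (HA : in_var E A) (th : crel A) : is_cong A th ->
  th <> Nabla A -> exists p, is_max A p /\ subrel th p.
Proof.
move=> Hth nth.
have [a _] : exists a : A, True.
  apply: NNPP => h; apply: nth; apply: Nabla_sub => x.
  by case: h; exists x.
(* Adjoining th makes the empty chain harmless in Zorn's lemma. *)
pose rl (X : A * A -> Prop) : crel A := fun x y => th x y \/ X (x, y).
pose P X := is_cong A (rl X) /\ rl X <> Nabla A.
have rl_mono X Y : classical_sets.subset X Y -> subrel (rl X) (rl Y).
  by move=> XY x y [h|/XY h]; [left | right].
have rl0 : rl classical_sets.set0 = th.
  by apply: crel_ext => x y; [case | left].
have [F FP tot|M [[HM nM] maxM]] := @classical_sets.Zorn_bigcup _ P.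
  pose F' X := X = classical_sets.set0 \/ F X.
  have F'P X : F' X -> P X by case=> [->|/FP //]; rewrite /P rl0.
  have F'tot X Y : F' X -> F' Y ->
      classical_sets.subset X Y \/ classical_sets.subset Y X.
    case=> [->|FX]; first by left.
    by case=> [->|FY]; [right | exact: tot].
  set U := classical_sets.bigcup _ _.
  have UE x y : rl U x y <-> exists X, F' X /\ rl X x y.
    split=> [[h|[X FX h]]|[X [[->|FX]]]].
    - by exists classical_sets.set0; split; left.
    - by exists X; split; right.
    - by rewrite rl0; left.
    - by case=> h; [left | right; exists X].
  have F'0 : F' classical_sets.set0 by left.
  have fin (I : finType) (x y : I -> A) : (forall i, rl U (x i) (y i)) ->
      exists X, F' X /\ forall i, rl X (x i) (y i).
    move=> h; apply: (chain_finite_bound I _ F' (@classical_sets.subset _)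
      (fun i X => rl X (x i) (y i)) _ F'0 F'tot).
      by move=> i X Y /rl_mono; apply.
    by move=> i; apply/UE.
  split.
    split; [|split; [|split]].
    - by move=> x; left; case: Hth.
    - move=> x y /UE [X [FX h]]; apply/UE; exists X; split=> //.
      by case: (F'P _ FX) => -[_ [s _]] _; apply: s.
    - move=> x y z xy yz.
      (* The two related pairs, indexed by [bool], lie in a common member of the chain. *)
      have [|X [FX h]] := fin bool (fun b => if b then x else y)
        (fun b => if b then y else z); first by case.
      apply/UE; exists X; split=> //; case: (F'P _ FX) => -[_ [_ [t _]]] _.
      exact: t (h true) (h false).
    - move=> f u v /fin [X [FX h]]; apply/UE; exists X; split=> //.
      by case: (F'P _ FX) => -[_ [_ [_ o]]] _; apply: o.
  move=> Utot.
  have [|X [FX h]] := fin (sym S) (fun _ => a) (fun f => op A f (fun _ => a)).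
    by move=> f; rewrite Utot.
  case: (F'P _ FX) => HX; apply.
  exact: (semidegenerate_cong_total Hsd A HA _ HX a).
exists (rl M); split; last by left.
split=> //; split=> // q Hq Mq.
case: (classic (q = Nabla A)) => [|nq]; [by right | left].
apply: NNPP => qM; apply: (maxM (fun z => q z.1 z.2)).
  split; first by case=> x y h; apply: Mq; right.
  move=> h; apply: qM; apply: crel_ext => // x y k; right.
  exact: (h (x, y)).
rewrite /P; have -> : rl (fun z => q z.1 z.2) = q; last by [].
by apply: crel_ext => x y; [case=> // h; apply: Mq; left | right].
Qed.

(** * Clopen sets of maximal congruences *)

Lemma max_complement {S} {E : identity S -> Prop} (HCM : cong_modular_var E)
  (Hsd : semidegenerate_var E) (A : algebra S) (HA : in_var E A)
  (p a b : crel A) : is_max A p -> is_cong A a -> is_cong A b ->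
  subrel (cmeet A a b) p -> cjoin A a b = Nabla A ->
  (subrel b p <-> ~ subrel a p).
Proof.
move=> Hp Ha Hb m j; split=> [bp ap|nap]; first exact: max_not_both Hp j ap bp.
by case: (max_cmeet_prime HCM Hsd A HA p a b).
Qed.

(** Every maximal congruence contains exactly one of [a] and [b], so [b] defines the complementary
    open set. Asking for the meet only below [Rad A] covers both Boolean congruences of [A] and
    lifts from the quotient. *)
Lemma clopen_max_complement {S} {E : identity S -> Prop}
  (HCM : cong_modular_var E) (Hsd : semidegenerate_var E) (A : algebra S)
  (HA : in_var E A) (a b : crel A) : is_cong A a -> is_cong A b ->
  subrel (cmeet A a b) (Rad A) -> cjoin A a b = Nabla A ->
  clopen_max A (gmap A a).
Proof.
move=> Ha Hb m j; split; first by exists a.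
exists b; split=> //; apply: pred_ext => p.
have C : is_max A p -> (subrel b p <-> ~ subrel a p).
  by move=> Hp; apply: (max_complement HCM Hsd A HA p a b) => // x y /m; apply.
by rewrite /gmap; tauto.
Qed.

Lemma cjoin_total {S} {E : identity S -> Prop} (Hsd : semidegenerate_var E)
  (A : algebra S) (HA : in_var E A) (a b : crel A) :
  (forall p, is_max A p -> subrel a p -> ~ subrel b p) ->
  cjoin A a b = Nabla A.
Proof.
move=> h; apply: NNPP => n.
have [p [Hp jp]] := max_exists Hsd A HA _ (cjoin_cong A a b) n.
by apply: (h p Hp) => x y k; apply: jp; [apply: cjoinl | apply: cjoinr].
Qed.

(** A maximal congruence above [a] and [c] would contain [b] too, against the totality of the join
    of [b] and [c]. So [c] and [a] have total join and [sub_of_cmeet_sub] applies. *)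
Lemma complemented_sub {S} {E : identity S -> Prop} (HCM : cong_modular_var E)
  (Hsd : semidegenerate_var E) (A : algebra S) (HA : in_var E A)
  (a b c : crel A) : is_cong A a -> is_cong A b -> is_cong A c ->
  subrel (cmeet A b c) a -> cjoin A b c = Nabla A ->
  (forall p, is_max A p -> subrel a p -> subrel b p) -> subrel b a.
Proof.
move=> Ha Hb Hc m j ab.
apply: (sub_of_cmeet_sub HCM Hsd A HA c b a) => //.
  apply: (cjoin_total Hsd A HA) => p Hp cp ap.
  exact: max_not_both Hp j (ab p Hp ap) cp.
by move=> x y [h k]; apply: m.
Qed.

Lemma gmapP {S} {A : algebra S} {a b : crel A} : gmap A a = gmap A b ->
  forall p, is_max A p -> (subrel a p <-> subrel b p).
Proof.
move=> e p Hp; have : gmap A a p <-> gmap A b p by rewrite e.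
rewrite /gmap; case: (classic (subrel a p)); case: (classic (subrel b p));
  tauto.
Qed.

Lemma Delta_sub {S} {A : algebra S} {a b c : crel A} : is_cong A c ->
  cmeet A a b = Delta A -> subrel (cmeet A a b) c.
Proof. by move=> [r _] -> x y ->; apply: r. Qed.

Theorem theorem5p17 (S : signature) (E : identity S -> Prop)
  (HCM : cong_modular_var E) (Hsd : semidegenerate_var E)
  (Hstand : forall B : algebra S, in_var E B ->
              compact_comm_closed B /\ ret_preserves_bc B)
  (A : algebra S) (HA : in_var E A) :
  CBLP A (Rad A) <-> g_bool_iso A.
Proof.
have HR := Rad_cong A.
have bool_sub al a : is_boolean A al -> is_cong A a ->
    (forall p, is_max A p -> subrel a p -> subrel al p) -> subrel al a.
  move=> [Hal [al' [Hal' [m j]]]] Ha.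
  by apply: (complemented_sub HCM Hsd A HA a al al') => //; apply: Delta_sub.
split; last first.
  (* The lift [b] of [be] defines a clopen set, which surjectivity writes as [gmap A al]; then [b]
     and the join of [al] with [Rad A] lie below the same maximal congruences. *)
  move=> [_ [_ [_ [_ [_ [_ surj]]]]]] be Hbe.
  have Hbc : is_cong _ be by case: Hbe.
  have [c [Hc [Rc [m j]]]] := boolean_qlift be HR Hbe.
  have Hb := qlift_cong be HR Hbc.
  have Rb := sub_qlift be HR Hbc.
  set b := qlift A (Rad A) be in m j Hb Rb.
  have [al [Hal eal]] :=
    surj _ (clopen_max_complement HCM Hsd A HA b c Hb Hc m j).
  exists al; split=> //; rewrite -(qrel_qlift A (Rad A) be) -/b; congr qrel.
  apply: crel_ext.
    apply: cjoin_sub => //; apply: bool_sub => // p Hp.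
    by move/(gmapP eal p Hp).
  apply: (complemented_sub HCM Hsd A HA _ b c) => //.
  - exact: cjoin_cong.
  - by move=> x y h; apply: cjoinr; apply: m.
  - move=> p Hp h; apply/(gmapP eal p Hp) => x y k.
    by apply: h; apply: cjoinl.
move=> cblp; split; [|split; [|split; [|split; [|split; [|split]]]]].
- move=> al [Hal [al' [Hal' [m j]]]].
  by apply: (clopen_max_complement HCM Hsd A HA al al') => //; apply: Delta_sub.
- move=> al be [Hal _] [Hbe _]; apply: pred_ext => p; split.
    by move=> [Hp n]; split; split=> // h; apply: n => x y [? ?]; apply: h.
  move=> [[Hp na] [_ nb]]; split=> // /(max_cmeet_prime HCM Hsd A HA p _ _ Hp).
  by case.
- move=> al be [Hal _] [Hbe _]; apply: pred_ext => p; split.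
    move=> [Hp n]; apply: NNPP => h; apply: n; apply: cjoin_sub.
    + by case: Hp.
    + by apply: NNPP => k; apply: h; left.
    + by apply: NNPP => k; apply: h; right.
  by case=> -[Hp n]; split=> // h; apply: n => x y k; apply: h;
     [apply: cjoinl | apply: cjoinr].
- apply: pred_ext => p; split=> // -[[[r _] _] n].
  by apply: n => x y ->; apply: r.
- apply: pred_ext => p; split=> [[]//|Hp]; split=> // h.
  by case: Hp => _ [n _]; apply: n; apply: Nabla_sub.
- move=> al be Hal Hbe e; apply: crel_ext; apply: bool_sub => //.
  + by case: Hbe.
  + by move=> p Hp /(gmapP e p Hp).
  + by case: Hal.
  + by move=> p Hp /(gmapP e p Hp).
move=> U [[th [Hth Uth]] [ch [Hch Uch]]].
have UE p : is_max A p -> (subrel th p <-> ~ subrel ch p).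
  move=> Hp.
  have h1 : U p <-> is_max A p /\ ~ subrel th p by rewrite Uth.
  have h2 : is_max A p /\ ~ U p <-> is_max A p /\ ~ subrel ch p.
    by rewrite -[X in X <-> _]/((fun p => is_max A p /\ ~ U p) p) Uch.
  by case: (classic (subrel th p)) => ?; tauto.
(* Joining with [Rad A] leaves the maximal congruences above [th] and [ch] unchanged. Each of these
   contains exactly one of the two, which gives the meet condition [m] and the join condition
   [j]. *)
pose b := cjoin A th (Rad A); pose c := cjoin A ch (Rad A).
have Hb : is_cong A b by exact: cjoin_cong.
have Hc : is_cong A c by exact: cjoin_cong.
have sub_max a p : is_max A p -> subrel (cjoin A a (Rad A)) p <-> subrel a p.
  move=> Hp; split=> [h x y k|ap]; first by apply: h; apply: cjoinl.
  by apply: cjoin_sub => //; [case: Hp | move=> x y; apply].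
have Rb : subrel (Rad A) b by exact: cjoinr.
have Rc : subrel (Rad A) c by exact: cjoinr.
have m : subrel (cmeet A b c) (Rad A).
  move=> x y [bxy cxy] p Hp; case: (classic (subrel th p)) => [thp|nthp].
    by apply: (proj2 (sub_max th p Hp)).
  apply: (proj2 (sub_max ch p Hp)) => //; apply: NNPP => n.
  by apply: nthp; apply/UE.
have j : cjoin A b c = Nabla A.
  apply: (cjoin_total Hsd A HA) => p Hp /(sub_max th p Hp) /(UE p Hp) n.
  by move=> /(sub_max ch p Hp).
have [al [Hal eal]] := cblp _ (boolean_qrel HR Hb Hc Rb Rc m j).
(* Both sides lie above [Rad A], so equality of their images in the quotient gives equality in
   [A]. *)
have e : cjoin A al (Rad A) = b.
  have Hj := cjoin_cong A al (Rad A); have Rj := cjoinr A al (Rad A).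
  by apply: crel_ext => x y /(qrelE HR) h; [apply/(qrelE HR Hb Rb); rewrite -eal
    | apply/(qrelE HR Hj Rj); rewrite eal]; apply: h.
exists al; split=> //; rewrite Uth; apply: pred_ext => p; rewrite /gmap.
have := sub_max al p; have := sub_max th p; rewrite -/b e; tauto.
Qed.
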